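(* Let $n\ge 1$ and let $a\le b$ be integers. The number of regions of $\mathcal{A}[K_n^{ab}]$ is $$(bn+2)(bn+3)\cdots(bn+n)\quad\text{if } a+b=0,$$ and $$(bn+1)^{n-1}\quad\text{if } a+b=1.$$
   Context: For integers $a\le b$, $[a,b]=\{k\in\mathbb{Z}: a\le k\le b\}$. $\mathcal{A}[K_n^{ab}]$ is the affine hyperplane arrangement in $\mathbb{R}^n$ consisting of all hyperplanes $x_j-x_i=g$ with $1\le i<j\le n$ and $g\in[a,b]$. Its regions are the connected components of the complement in $\mathbb{R}^n$ of the union of the hyperplanes. Empty products equal $1$. *)

(* Defs.v *)
From HB Require Import structures.
From mathcomp Require Import all_boot all_order all_algebra.
From mathcomp Require Import all_classical all_reals all_analysis.
Set Implicit Arguments.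
Unset Strict Implicit.
Unset Printing Implicit Defensive.
Import Order.TTheory GRing.Theory Num.Theory.
Import numFieldNormedType.Exports.
Local Open Scope classical_set_scope.
Local Open Scope ring_scope.

(* R^n is 'rV[R]_n with the topology of the library (the product topology);
   the coordinates x_1, ..., x_n are x ord0 i for i : 'I_n. *)

Definition hyperplane (R : realType) (n : nat) (i j : 'I_n) (g : int) :
    set 'rV[R]_n :=
  [set x | x ord0 j - x ord0 i = g%:~R].
Arguments hyperplane R {n} i j g.

Definition arrangementK (R : realType) (n : nat) (a b : int) :
    set (set 'rV[R]_n) :=
  [set H | exists i j : 'I_n, exists g : int,
     [/\ (i < j)%N, a <= g <= b & H = hyperplane R i j g]].
Arguments arrangementK R n a b : clear implicits.

Definition arr_complement (R : realType) (n : nat) (A : set (set 'rV[R]_n)) :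
    set 'rV[R]_n :=
  ~` \bigcup_(H in A) H.

Definition regions (R : realType) (n : nat) (A : set (set 'rV[R]_n)) :
    set (set 'rV[R]_n) :=
  [set connected_component (arr_complement A) x | x in arr_complement A].

(* The cardinality is asserted as a bijection with {0, ..., N-1}, so that
   finiteness of the set of regions is part of the claim. *)
Definition has_num_regions (R : realType) (n : nat) (A : set (set 'rV[R]_n))
    (N : nat) : Prop :=
  (regions A #= `I_N)%card.

(* Main.v *)
(* Regions are the realizable sign vectors of the affine forms x_j - x_i - g.
   Their number obeys deletion-contraction (Zaslavsky), and so does the number
   c_q of points of (Z/q)^n avoiding the hyperplanes; hence q^-n c_q = P(1/q)
   for all large q, where P is a polynomial whose value at -1 is the number of
   regions.  To find c_q, rotate so that x_0 = 0.  The other coordinates are then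
   placed on a segment with gaps at least b + 1, or only b between a larger index
   and a smaller one on its right in the Shi case; removing b places per gap
   leaves an arbitrary (Shi) or injective (Catalan) function. *)

Require Import Defs.
From HB Require Import structures.
From mathcomp Require Import all_boot all_order all_algebra.
From mathcomp Require Import all_classical all_reals all_analysis.
From mathcomp Require Import zify ring lra.
Import Order.TTheory GRing.Theory Num.Theory.
Import numFieldNormedType.Exports.

(** * Placements with prescribed gaps *)

Section Spacing.
Context {m : nat}.
Implicit Types (x y : 'I_m -> nat) (i j k : 'I_m).

(* Ties are broken in favour of the larger index. *)
Definition precedes y j i : bool := (y j < y i) || ((y j == y i) && (i < j)).

Definition rank y i : nat := #|[set j | precedes y j i]|.

(* [d = true] is the Shi case (one extra unit at ascents only) and [d = false]
   the Catalan case (one extra unit always). *)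
Definition extra (d : bool) j i : nat := ~~ d || (j < i).

Definition spaced d b y : bool :=
  [forall j, forall i, precedes y j i ==> (y j + b + extra d j i <= y i)].

Lemma spacedP d b y :
  reflect (forall j i, precedes y j i -> y j + b + extra d j i <= y i)
          (spaced d b y).
Proof.
apply: (iffP forallP) => [H j i|H j]; first by move/implyP: (forallP (H j) i).
by apply/forallP => i; apply/implyP; apply: H.
Qed.

Lemma precedes_irr y i : precedes y i i = false.
Proof. by rewrite /precedes !ltnn eqxx. Qed.

Lemma precedes_trans y k j i : precedes y j k -> precedes y k i -> precedes y j i.
Proof. by rewrite /precedes; lia. Qed.

Lemma precedes_total y j i : j != i -> precedes y j i || precedes y i j.
Proof. by rewrite -val_eqE /precedes /=; lia. Qed.

Lemma precedes_asym y j i : precedes y j i -> ~~ precedes y i j.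
Proof. by rewrite /precedes; lia. Qed.

(** Both relations are strict total orders, and one such order cannot be properly contained in
    another. *)
Lemma precedes_mono x y : (forall j i, precedes x j i -> precedes y j i) ->
  precedes x =2 precedes y.
Proof.
move=> xy j i; apply/idP/idP; first exact: xy.
move=> yji; have [ij|ij] := eqVneq j i; first by rewrite ij precedes_irr in yji.
case/orP: (precedes_total x _ _ ij) => // /xy yij.
by move: (precedes_asym _ _ _ yji); rewrite yij.
Qed.

Lemma eq_rank x y : precedes x =2 precedes y -> rank x =1 rank y.
Proof. by move=> xy i; apply: eq_card => j; rewrite !inE xy. Qed.

Lemma rank_lt y j i : precedes y j i -> rank y j < rank y i.
Proof.
move=> ji; apply/proper_card/properP; split.
  by apply/fintype.subsetP => k; rewrite !inE => /precedes_trans; apply.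
by exists j; rewrite !inE // precedes_irr.
Qed.

Lemma rank_ltm y i : rank y i < m.
Proof.
rewrite -[X in _ < X]card_ord; apply/proper_card/properP; split.
  by apply/fintype.subsetP.
by exists i; rewrite // inE precedes_irr.
Qed.

Lemma rank_inj y : injective (rank y).
Proof.
move=> j i ji; apply/eqP/negPn/negP => /(precedes_total y) /orP [] /rank_lt;
  by rewrite ji ltnn.
Qed.

Lemma precedes_rank y j i : precedes y j i = (rank y j < rank y i).
Proof.
apply/idP/idP; first exact: rank_lt.
have [->|ji] := eqVneq j i; first by rewrite ltnn.
by case/orP: (precedes_total y _ _ ji) => // /rank_lt; lia.
Qed.

Lemma rank_onto y r : r < m -> exists i, rank y i = r.
Proof.
move=> rm; pose f i := Ordinal (rank_ltm y i).
have f_inj : injective f by move=> i j [] /rank_inj.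
have [g fg gf] := injF_bij f_inj.
by exists (g (Ordinal rm)); have := congr1 val (gf (Ordinal rm)).
Qed.

(** Inserts [b] places for each predecessor of [i]. The inverse [squeeze] uses truncated
    subtraction, which is exact on spaced placements by [spaced_rank_le]. *)
Definition spread b y i := y i + b * rank y i.
Definition squeeze b x i := x i - b * rank x i.

Lemma precedes_spread b y : precedes y =2 precedes (spread b y).
Proof.
apply: precedes_mono => j i ji; have := rank_lt _ _ _ ji; move: ji.
(* For [b = 0] ties survive with their tie-break; for [b > 0] the ranks turn them into strict
   inequalities. *)
rewrite /precedes /spread; case: b => [|b]; first by rewrite !mul0n !addn0.
by move=> ji rji; apply/orP; left; nia.
Qed.

Lemma spaced_spread d b y : spaced d 0 y -> spaced d b (spread b y).
Proof.
move/spacedP => sy; apply/spacedP => j i; rewrite -precedes_spread => ji.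
by have := sy _ _ ji; have := rank_lt _ _ _ ji; rewrite /spread; nia.
Qed.

(** Induction along the chain of consecutive ranks from [j] to [i], each link contributing [b]. The
    extra unit survives because [j < i] forces [j < k] or [k < i] for every intermediate [k]. *)
Lemma spaced_rank d b x j i : spaced d b x -> precedes x j i ->
  x j + b * (rank x i - rank x j) + extra d j i <= x i.
Proof.
move/spacedP => sx; have [r] := ubnP (rank x i); elim: r i => // r IH i ir ji.
have rji := rank_lt _ _ _ ji.
have [k kr] := rank_onto x (rank x i).-1 (leq_ltn_trans (leq_pred _) (rank_ltm x i)).
have ki : precedes x k i by rewrite precedes_rank; lia.
have [kj|kj] := eqVneq k j.
  rewrite -kj in rji *; have -> : rank x i - rank x k = 1 by lia.
  by rewrite muln1; apply: sx.
have jk : precedes x j k.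
  have : rank x k <> rank x j by move=> /rank_inj /eqP; rewrite (negPf kj).
  by rewrite precedes_rank; lia.
have := IH k ltac:(lia) jk; have := sx _ _ ki.
have -> : rank x i - rank x j = (rank x k - rank x j).+1.
  by have := rank_lt _ _ _ jk; lia.
by rewrite mulnS /extra; case: d {sx IH}; lia.
Qed.

Lemma spaced_rank_le d b x i : spaced d b x -> b * rank x i <= x i.
Proof.
move=> sx; have [j j0] := rank_onto x 0 (leq_ltn_trans (leq0n _) (ltn_ord i)).
have [ri|ri] := posnP (rank x i); first by rewrite ri muln0.
have := spaced_rank d b x j i sx; rewrite precedes_rank j0 subn0 => /(_ ri).
by lia.
Qed.

Lemma squeeze_precedes d b x j i : spaced d b x -> precedes x j i ->
  squeeze b x j + extra d j i <= squeeze b x i.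
Proof.
move=> sx ji; have := spaced_rank d b x j i sx ji; have := rank_lt _ _ _ ji.
have := spaced_rank_le d b x i sx; have := spaced_rank_le d b x j sx.
by rewrite /squeeze mulnBr; nia.
Qed.

Lemma precedes_squeeze d b x : spaced d b x ->
  precedes x =2 precedes (squeeze b x).
Proof.
move=> sx; apply: precedes_mono => j i ji.
have := squeeze_precedes d b x j i sx ji; have : j <> i :> nat.
  by move=> /val_inj e; rewrite e precedes_irr in ji.
by rewrite /precedes /extra; case: d {sx}; lia.
Qed.

Lemma spaced_squeeze d b x : spaced d b x -> spaced d 0 (squeeze b x).
Proof.
move=> sx; apply/spacedP => j i; rewrite -(precedes_squeeze d) // => ji.
by rewrite addn0; apply: squeeze_precedes.
Qed.

Lemma spreadK b y : squeeze b (spread b y) =1 y.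
Proof.
by move=> i; rewrite /squeeze -(eq_rank _ _ (precedes_spread b y)) addnK.
Qed.

Lemma squeezeK d b x : spaced d b x -> spread b (squeeze b x) =1 x.
Proof.
move=> sx i; rewrite /spread -(eq_rank _ _ (precedes_squeeze d b x sx)) subnK //.
exact: (spaced_rank_le d).
Qed.

Lemma spread_lt b M y i : y i < M -> spread b y i < M + b * m.-1.
Proof. by move=> yM; have := rank_ltm y i; rewrite /spread; nia. Qed.

(** Squeezing preserves the order, so it suffices to bound the element of top rank [m.-1], from
    which exactly [b * m.-1] is removed. *)
Lemma squeeze_lt d b M x i : spaced d b x -> (forall j, x j < M + b * m.-1) ->
  squeeze b x i < M.
Proof.
move=> sx xM; have m0 : 0 < m := leq_ltn_trans (leq0n _) (ltn_ord i).
have [k kr] := rank_onto x m.-1 ltac:(lia).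
have kM : squeeze b x k < M.
  by have := xM k; have := spaced_rank_le d b x k sx; rewrite /squeeze kr; lia.
have [->//|ik] := eqVneq i k.
have : precedes x i k.
  have : rank x i <> rank x k by move=> /rank_inj /eqP; rewrite (negPf ik).
  by rewrite precedes_rank kr; have := rank_ltm x i; lia.
by move/(squeeze_precedes d b _ _ _ sx); lia.
Qed.

End Spacing.

Definition vals {m M : nat} (y : {ffun 'I_m -> 'I_M}) : 'I_m -> nat := fun i => y i.

Lemma eq_spaced {m} d b (x y : 'I_m -> nat) : x =1 y -> spaced d b x = spaced d b y.
Proof.
move=> xy; apply/spacedP/spacedP => H j i; have := H j i;
  by rewrite /precedes !xy.
Qed.

Lemma card_spaced (m M b : nat) (d : bool) :
  #|[set y : {ffun 'I_m -> 'I_(M + b * m.-1)} | spaced d b (vals y)]| =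
  #|[set y : {ffun 'I_m -> 'I_M} | spaced d 0 (vals y)]|.
Proof.
pose Phi (y : {ffun 'I_m -> 'I_M}) : {ffun 'I_m -> 'I_(M + b * m.-1)} :=
  [ffun i => Ordinal (spread_lt b M (vals y) i (ltn_ord _))].
have PhiE y : vals (Phi y) =1 spread b (vals y) by move=> i; rewrite /vals ffunE.
have eq_spread (y z : 'I_m -> nat) : y =1 z -> spread b y =1 spread b z.
  move=> yz i; rewrite /spread yz (eq_rank y z) // => j k.
  by rewrite /precedes !yz.
have Phi_inj : injective Phi.
  move=> y z yz; apply/ffunP => i; apply: val_inj.
  change (vals y i = vals z i); rewrite -(spreadK b (vals y)) -(spreadK b (vals z)).
  have se : spread b (vals y) =1 spread b (vals z) by move=> k; rewrite -!PhiE yz.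
  rewrite /squeeze se (eq_rank _ (spread b (vals z))) // => j k.
  by rewrite /precedes !se.
rewrite -(card_imset _ Phi_inj); apply: eq_card => x.
rewrite inE; apply/idP/imsetP => [sx|[y]]; last first.
  by rewrite inE => /(spaced_spread d b) sy ->; rewrite (eq_spaced _ _ _ _ (PhiE y)).
pose y : {ffun 'I_m -> 'I_M} :=
  [ffun i => Ordinal (squeeze_lt d b M (vals x) i sx (fun j => ltn_ord _))].
have yE : vals y =1 squeeze b (vals x) by move=> i; rewrite /vals ffunE.
exists y; first by rewrite inE (eq_spaced _ _ _ _ yE) spaced_squeeze.
apply/ffunP => i; apply: val_inj; change (vals x i = vals (Phi y) i).
by rewrite PhiE (eq_spread _ _ yE) (squeezeK d).
Qed.

(** With [b = 0] nothing is required: a tie is ordered by decreasing index, where [extra] vanishes,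
    and a strict inequality already supplies the one unit. *)
Lemma card_spaced_shi (m M : nat) :
  #|[set y : {ffun 'I_m -> 'I_M} | spaced true 0 (vals y)]| = (M ^ m)%N.
Proof.
rewrite -[in RHS](card_ord m) -[X in (X ^ _)%N](card_ord M) -card_ffun.
apply: eq_card => y; rewrite !inE; apply/spacedP => j i.
by rewrite /precedes /extra; lia.
Qed.

(** The unit is now required of every pair, which excludes exactly the ties. *)
Lemma card_spaced_catalan (m M : nat) :
  #|[set y : {ffun 'I_m -> 'I_M} | spaced false 0 (vals y)]| = M ^_ m.
Proof.
rewrite -[in RHS](card_ord m) -[X in X ^_ _](card_ord M) -card_inj_ffuns.
apply: eq_card => y; rewrite !inE; apply/spacedP/injectiveP => [sy i j ij|yi j i].
  apply/eqP/negPn/negP => /(precedes_total (vals y)); have := congr1 val ij.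
  by have := sy i j; have := sy j i; rewrite /precedes /extra /vals /=; lia.
have [->|ij] := eqVneq i j; first by rewrite precedes_irr.
have : y i <> y j :> nat by move=> /val_inj /yi /eqP; rewrite (negPf ij).
by rewrite /precedes /extra /vals /=; lia.
Qed.

Local Open Scope classical_set_scope.
Local Open Scope ring_scope.

(** * Sign vectors and deletion-contraction *)

(* [(u, v, g)] stands for the hyperplane x_v - x_u = g. *)
Definition edge (n : nat) : Type := ('I_n * 'I_n * int)%type.

Section Edges.
Context {F : comNzRingType} {n : nat}.
Implicit Types (e f : edge n) (x : 'I_n -> F).

(** Defined over any commutative ring, so that real points and points over Z/q share the algebra of
    contraction. *)
Definition gap f x : F := x f.1.2 - x f.1.1 - f.2%:~R.

Definition avoids (A : seq (edge n)) x : bool := all (fun f => gap f x != 0) A.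

Definition push x (j : 'I_n) (c : F) : 'I_n -> F :=
  fun k => x k + (if k == j then c else 0).

Definition onto e x : 'I_n -> F :=
  fun k => if k == e.1.2 then x e.1.1 + e.2%:~R else x k.

(** Pullback of [f] along the projection [onto e]. The number of coordinates stays [n]: for a
    non-loop [e] its head becomes free instead of being removed. Contraction may create loops, hence
    the loop lemmas. *)
Definition contract e f : edge n :=
  let tail k := if k == e.1.2 then e.1.1 else k in
  let offset k := if k == e.1.2 then e.2 else 0 in
  (tail f.1.1, tail f.1.2, f.2 + offset f.1.1 - offset f.1.2).

Lemma gap_contract e f x : gap (contract e f) x = gap f (onto e x).
Proof.
rewrite /gap /contract /onto /= rmorphB rmorphD /=.
by case: (f.1.1 == _); case: (f.1.2 == _); rewrite /= ?mulr0z; ring.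
Qed.

Lemma avoids_contract e (A : seq (edge n)) x :
  avoids (map (contract e) A) x = avoids A (onto e x).
Proof.
by rewrite /avoids all_map; apply: eq_all => f /=; rewrite gap_contract.
Qed.

Lemma onto_push e x c : e.1.1 != e.1.2 -> onto e (push x e.1.2 c) = onto e x.
Proof.
move=> ne; apply/funext => k; rewrite /onto /push (negPf ne) addr0.
by case: eqP => // _; rewrite addr0.
Qed.

Lemma gap_push_head e x c : e.1.1 != e.1.2 ->
  gap e (push x e.1.2 c) = gap e x + c.
Proof.
by move=> ne; rewrite /gap /push eqxx (negPf ne) addr0 -!addrA [c + _]addrC !addrA.
Qed.

Lemma gap_onto e x : e.1.1 != e.1.2 -> gap e (onto e x) = 0.
Proof.
by move=> ne; rewrite /gap /onto eqxx (negPf ne) [x _ + _]addrC addrK subrr.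
Qed.

Lemma onto_id e x : gap e x = 0 -> onto e x = x.
Proof.
move=> /eqP; rewrite /gap subr_eq0 subr_eq => /eqP xe.
by apply/funext => k; rewrite /onto; case: eqP => // ->; rewrite xe addrC.
Qed.

Lemma gap_loop e x : e.1.1 = e.1.2 -> gap e x = - e.2%:~R.
Proof. by rewrite /gap => ->; rewrite subrr add0r. Qed.

End Edges.

Section SignVectors.
Context {R : realFieldType} {n : nat}.
Implicit Types (e f : edge n) (x y : 'I_n -> R).

Definition signs {m} (A : m.-tuple (edge n)) x : m.-tuple bool :=
  [tuple of map (fun f => 0 < gap f x) A].

Definition realizable {m} (A : m.-tuple (edge n)) : {set m.-tuple bool} :=
  [set t | `[< exists2 x : 'I_n -> R, avoids A x & signs A x = t >]].

Lemma realizableP {m} (A : m.-tuple (edge n)) t :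
  reflect (exists2 x : 'I_n -> R, avoids A x & signs A x = t) (t \in realizable A).
Proof. by rewrite inE; apply: asboolP. Qed.

Lemma signs_contract {m} (A : m.-tuple (edge n)) e x :
  signs [tuple of map (contract e) A] x = signs A (onto e x).
Proof.
apply: val_inj; rewrite /= -map_comp; apply: eq_map => f /=.
by rewrite gap_contract.
Qed.

Lemma gap_away (A : seq (edge n)) x : avoids A x ->
  exists2 d : R, 0 < d & forall f, f \in A -> d <= `|gap f x|.
Proof.
elim: A => [|f A IH] /=; first by exists 1.
case/andP => f0 /IH [d d0 dA]; exists (Num.min d `|gap f x|).
  by rewrite lt_min d0 normr_gt0.
move=> g; rewrite inE => /predU1P [->|gA]; first by rewrite ge_min lexx orbT.
by rewrite ge_min dA.
Qed.

Lemma gap_push_le f x j c : `|gap f (push x j c) - gap f x| <= `|c|.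
Proof.
rewrite /gap /push; set p := (if _ then _ else _); set q := (if _ then _ else _).
have -> : x f.1.2 + p - (x f.1.1 + q) - f.2%:~R - (x f.1.2 - x f.1.1 - f.2%:~R)
  = p - q by ring.
rewrite /p /q; case: (_ == j); case: (_ == j);
  by rewrite ?subrr ?subr0 ?sub0r ?normrN ?normr0 ?normr_ge0.
Qed.

(** Finitely many nonzero gaps are bounded away from 0, and pushing one coordinate by [c] moves each
    gap by at most [|c|]; half the bound preserves all signs. *)
Lemma perturb {m} (A : m.-tuple (edge n)) x j : avoids A x ->
  exists2 d : R, 0 < d &
    forall c, `|c| <= d -> avoids A (push x j c) /\ signs A (push x j c) = signs A x.
Proof.
move=> /gap_away [d d0 dA]; exists (d / 2); first by rewrite divr_gt0.
have close c f : `|c| <= d / 2 -> f \in tval A ->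
  gap f (push x j c) != 0 /\ (0 < gap f (push x j c)) = (0 < gap f x).
  move=> cd /dA df; have := le_trans (gap_push_le f x j c) cd.
  move: df; set g := gap f x; set h := gap f _ => dg hg.
  move: hg; rewrite ler_norml => /andP [h1 h2].
  have [g0|g0] := lerP 0 g; move: dg.
    rewrite ger0_norm // => dg; have g1 : 0 < g by lra.
    have h0 : 0 < h by lra.
    by rewrite h0 g1 gt_eqF.
  rewrite ltr0_norm // => dg; have h0 : h < 0 by lra.
  by rewrite lt_eqF // (lt_gtF h0) (lt_gtF g0).
move=> c cd; split; first by apply/allP => f fA; case: (close c f cd fA).
by apply: val_inj; apply/eq_in_map => f fA; case: (close c f cd fA).
Qed.

Lemma gap_segment f x y (s t : R) : s + t = 1 ->
  gap f (fun k => s * x k + t * y k) = s * gap f x + t * gap f y.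
Proof. by move=> st; rewrite /gap -[f.2%:~R in LHS]mul1r -st; ring. Qed.

(** Gaps are affine, so cells are convex. *)
Lemma avoids_segment {m} (A : m.-tuple (edge n)) x y (s t : R) :
  0 <= s -> 0 <= t -> s + t = 1 ->
  avoids A x -> avoids A y -> signs A x = signs A y ->
  let z := fun k => s * x k + t * y k in avoids A z /\ signs A z = signs A x.
Proof.
move=> s0 t0 st /allP Ax /allP Ay /(congr1 val) /eq_in_map sxy z.
have gz f := gap_segment f x y s t st.
have same f : f \in tval A -> gap f z != 0 /\ (0 < gap f z) = (0 < gap f x).
  move=> fA; move: (Ax _ fA) (Ay _ fA) (sxy _ fA) (gz f).
  move: (gap f x) (gap f y) (gap f z) => u v w u0 v0 uv ->.
  have [u1|u1] := ltP 0 u; move: uv.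
    rewrite u1 => /esym v1; have w0 : 0 < s * u + t * v.
      (* Strictness comes from the term in [s], so the endpoint [s = 0] is treated apart. *)
      have [s_0|sn] := eqVneq s 0.
        by have -> : t = 1 by [lra]; rewrite s_0 mul0r add0r mul1r.
      apply: ltr_pwDl; last by rewrite mulr_ge0 // ltW.
      by rewrite mulr_gt0 // lt_neqAle eq_sym sn.
    by rewrite w0 gt_eqF.
  rewrite ltNge u1 /= => /esym /negbT; rewrite -leNgt => v1.
  have {u0}u1 : u < 0 by rewrite lt_neqAle u0.
  have {v0}v1 : v < 0 by rewrite lt_neqAle v0.
  have w0 : s * u + t * v < 0.
    have [s_0|sn] := eqVneq s 0.
        by have -> : t = 1 by [lra]; rewrite s_0 mul0r add0r mul1r.
    apply: ltr_nwDl; last by rewrite mulr_ge0_le0 // ltW.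
    by rewrite pmulr_rlt0 // lt_neqAle eq_sym sn.
  by rewrite lt_eqF // lt_gtF.
split; first by apply/allP => f /same [].
by apply: val_inj; apply/eq_in_map => f /same [].
Qed.

Definition fibre {m} (e : edge n) (A : m.-tuple (edge n)) (b : bool) :
    {set m.-tuple bool} :=
  [set t : m.-tuple bool | [tuple of b :: t] \in realizable [tuple of e :: A]].

Lemma fibreP {m} e (A : m.-tuple (edge n)) b t :
  reflect (exists x : 'I_n -> R, [/\ avoids A x, signs A x = t, gap e x != 0 &
                                    (0 < gap e x) = b])
          (t \in fibre e A b).
Proof.
rewrite inE; apply: (iffP (realizableP _ _)).
  move=> [x /= /andP [ex Ax] /(congr1 val) [<- st]]; exists x; split => //.
  exact: val_inj.
move=> [x [Ax st ex eb]]; exists x; first by rewrite /= ex.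
by apply: val_inj; rewrite /= eb -st.
Qed.

Lemma card_realizable_cons {m} e (A : m.-tuple (edge n)) :
  #|realizable [tuple of e :: A]| = (#|fibre e A true| + #|fibre e A false|)%N.
Proof.
have consI b : injective (fun t : m.-tuple bool => [tuple of b :: t]).
  by move=> s t /(congr1 val) [] /val_inj.
rewrite -(card_imset _ (consI true)) -(card_imset _ (consI false)).
rewrite -cardsUI [X in (_ + X)%N](_ : _ = 0%N) ?addn0; last first.
  apply/eqP; rewrite cards_eq0; apply/eqP/setP => t.
  rewrite finset.in_setI finset.in_set0.
  by apply/negP => /andP [/imsetP [? _ ->] /imsetP [? _ /(congr1 val)]].
congr #|pred_of_set _|; apply/setP => t; rewrite finset.in_setU.
case/tupleP: t => b t; apply/idP/orP.
  by move=> rt; case: b rt => rt; [left|right]; apply: imset_f; rewrite finset.in_set.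
by case=> /imsetP [s]; rewrite finset.in_set => ss ->.
Qed.

Lemma card_realizable_nil (A : 0.-tuple (edge n)) : #|realizable A| = 1%N.
Proof.
apply/eqP/cards1P; exists [tuple]; apply/setP => t; rewrite !tuple0 finset.in_set1 eqxx.
by apply/realizableP; exists (fun=> 0); rewrite ?tuple0.
Qed.

(** The gap along a loop is the constant [- e.2]. If it is 0 no point avoids it; otherwise one fibre
    is all of [realizable A] and the other is empty. *)
Lemma card_realizable_loop {m} e (A : m.-tuple (edge n)) : e.1.1 = e.1.2 ->
  #|realizable [tuple of e :: A]| = (if e.2 == 0 then 0%N else #|realizable A|).
Proof.
move=> le; have [e0|e0] := eqVneq e.2 0.
  apply/eqP; rewrite cards_eq0; apply/eqP/setP => t; rewrite finset.in_set0.
  by apply/negP => /realizableP [x /andP [/=]]; rewrite gap_loop // e0 oppr0 eqxx.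
have g0 x : gap e x != 0 :> R by rewrite gap_loop // oppr_eq0 intr_eq0.
have fb b : fibre e A b = if (0 < - e.2) == b then realizable A else finset.set0.
  apply/setP => t; rewrite -(ltr_int R) rmorphN /=.
  apply/fibreP/idP => [[x [Ax st _]]|].
    by rewrite gap_loop // => ->; rewrite eqxx; apply/realizableP; exists x.
  case: eqP => [eb /realizableP [x Ax st]|]; last by rewrite finset.in_set0.
  by exists x; split => //; rewrite gap_loop.
rewrite card_realizable_cons !fb; case: (0 < _); rewrite ?eqxx /=.
  by rewrite finset.cards0 addn0.
by rewrite finset.cards0.
Qed.

(* A sign vector of [A] extends to both sides of [e] exactly when its convex
   cell meets the hyperplane of [e]. *)
Lemma card_realizable_link {m} e (A : m.-tuple (edge n)) : e.1.1 != e.1.2 ->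
  #|realizable [tuple of e :: A]| =
  (#|realizable A| + #|realizable [tuple of map (contract e) A]|)%N.
Proof.
move=> ne; rewrite card_realizable_cons -cardsUI.
(* A point on the hyperplane of [e] can be pushed off it to either side without changing its signs
   on [A]. *)
have side x b : avoids A x -> gap e x = 0 -> signs A x \in fibre e A b.
  move=> /(perturb _ _ e.1.2) [d d0 dP] ex.
  pose c := if b then d else - d.
  have [|Ac sc] := dP c; first by rewrite /c; case: ifP => _; rewrite ?normrN gtr0_norm.
  apply/fibreP; exists (push x e.1.2 c).
  rewrite gap_push_head // ex add0r /c; split => //.
    by case: ifP => _; rewrite ?oppr_eq0 gt_eqF.
  by case: ifP => _; rewrite ?d0 // oppr_gt0 lt_gtF.
(* By inclusion-exclusion it remains to see that the union of the two fibres is [realizable A] and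
   that their intersection belongs to the contraction. *)
congr (_ + _)%N; congr #|pred_of_set _|; apply/setP => t;
  rewrite ?finset.in_setU ?finset.in_setI.
  apply/orP/realizableP => [[] /fibreP [x [Ax st _ _]]|[x Ax <-]]; try by exists x.
  have [ex|ex] := eqVneq (gap e x) 0; first by left; apply: side.
  by case: (ltP 0 (gap e x)) => gx; [left|right]; apply/fibreP; exists x; split => //;
    apply/negbTE; rewrite -leNgt.
apply/andP/realizableP.
  move=> [/fibreP [x [Ax sx ex px]] /fibreP [y [Ay sy ey /negbT py]]].
  rewrite -leNgt in py; have {ey}py : gap e y < 0 by rewrite lt_neqAle ey.
  set u := gap e x in px; set v := gap e y in py.
  have uv : 0 < u - v by lra.
  (* With these convex weights the affine function [gap e], of value [u] at [x] and [v] at [y],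
     vanishes. *)
  have st : - v / (u - v) + u / (u - v) = 1.
    by rewrite -mulrDl addrC divff // gt_eqF.
  have [||Az sz] := avoids_segment A x y _ _ _ _ st Ax Ay (etrans sx (esym sy)).
  - by apply: divr_ge0; rewrite ?oppr_ge0; apply: ltW.
  - by apply: divr_ge0; apply: ltW.
  have /= ez := gap_segment e x y _ _ st.
  move: Az sz ez; set z := (fun k => _) => Az sz.
  rewrite -/u -/v mulrAC [u / _ * _]mulrAC -mulrDl mulNr [u * v]mulrC addNr mul0r => ez.
  by exists z; rewrite ?avoids_contract ?signs_contract onto_id // sz.
move=> [x]; rewrite avoids_contract signs_contract => Ax <-.
by split; apply: side => //; apply: gap_onto.
Qed.

End SignVectors.

(** * Points over Z/q *)

Section Colorings.
Context {F : finComNzRingType} {n : nat}.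
Implicit Types (e : edge n) (A : seq (edge n)).

Definition colorings A : {set {ffun 'I_n -> F}} := [set x : {ffun _} | avoids A x].

Lemma in_colorings A (x : {ffun 'I_n -> F}) : (x \in colorings A) = avoids A x.
Proof. exact: finset.in_set. Qed.

(** The contracted list ignores the head of [e], so translating that coordinate by [- c] carries
    level [c] to level 0, where the contracted and original conditions agree. *)
Lemma card_gap_coloring e A (c : F) : e.1.1 != e.1.2 ->
  #|[set x : {ffun _} in colorings (map (contract e) A) | gap e x == c]| =
  #|[set x : {ffun _} in colorings A | gap e x == 0]|.
Proof.
move=> ne; pose T (d : F) (x : {ffun 'I_n -> F}) := finfun (push x e.1.2 d).
have TE d x : T d x = push x e.1.2 d :> ('I_n -> F) by apply/funext => k; rewrite ffunE.
have T_inj d : injective (T d).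
  move=> x y xy; apply/ffunP => k; have := congr1 (fun z : {ffun _} => z k) xy.
  by rewrite !ffunE; apply: addIr.
rewrite -(card_imset _ (T_inj (- c))); congr #|pred_of_set _|; apply/setP => x.
rewrite !(finset.in_set, in_colorings); apply/imsetP/andP.
  move=> [y]; rewrite !(finset.in_set, in_colorings) avoids_contract.
  move=> /andP [Ay /eqP gy] ->; have gT : gap e (T (- c) y) = 0.
    by rewrite TE gap_push_head // gy addrN.
  by rewrite gT -(onto_id _ _ gT) TE onto_push.
move=> [Ax /eqP gx]; exists (T c x).
  rewrite !(finset.in_set, in_colorings) avoids_contract TE onto_push // onto_id //.
  by rewrite Ax gap_push_head // gx add0r eqxx.
by apply/ffunP => k; rewrite !ffunE /push ffunE /push; case: eqP => _; ring.
Qed.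

(** Split by the value of [gap e], the contracted count is [#|F|] times the number of points of
    [colorings A] on the hyperplane of [e]. *)
Lemma card_colorings_link e A : e.1.1 != e.1.2 ->
  (#|F| * #|colorings (e :: A)| + #|colorings (map (contract e) A)| =
   #|F| * #|colorings A|)%N.
Proof.
move=> ne; pose Z := [set x : {ffun _} in colorings A | gap e x == 0]%SET.
have -> : #|colorings (map (contract e) A)| = (#|F| * #|Z|)%N.
  rewrite -sum1_card (partition_big (fun x : {ffun _} => gap e x) xpredT) //=.
  rewrite -sum_nat_const; apply: eq_bigr => c _.
  rewrite -(card_gap_coloring _ _ c) // -sum1_card; apply: eq_bigl => x.
  by rewrite !(finset.in_set, in_colorings).
rewrite -mulnDr; congr (_ * _)%N.
rewrite -(cardsID Z (colorings A)) addnC; congr (_ + _)%N; apply: eq_card => x.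
  by rewrite !(finset.in_set, in_colorings); case: (avoids A x).
rewrite !(finset.in_set, in_colorings) negb_and /=.
by case: (avoids A x); rewrite ?andbF.
Qed.

Lemma card_colorings_loop e A : e.1.1 = e.1.2 ->
  #|colorings (e :: A)| = (if e.2%:~R == 0 :> F then 0%N else #|colorings A|).
Proof.
move=> le; case: eqP => e0.
  by apply: eq_card0 => x; rewrite in_colorings /= gap_loop // e0 oppr0 eqxx.
apply: eq_card => x; rewrite !(finset.in_set, in_colorings) /= gap_loop // oppr_eq0.
by move/eqP: e0 => ->.
Qed.

Lemma card_colorings_nil : #|colorings [::]| = (#|F| ^ n)%N.
Proof.
rewrite -[in RHS](card_ord n) -card_ffun; apply: eq_card => x.
by rewrite in_colorings.
Qed.

End Colorings.
Arguments colorings F {n} A.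

Lemma dvdz_intr_Zp (q : nat) (g : int) :
  (g%:~R == 0 :> 'Z_q.+2) = (q.+2%:Z %| g)%Z.
Proof.
have natZ k : (k%:R == 0 :> 'Z_q.+2) = (q.+2 %| k)%N.
  by rewrite -val_eqE /= Zp_nat /= /dvdn.
case: g => k; rewrite /intmul /dvdz /=; first exact: natZ.
by rewrite oppr_eq0 natZ.
Qed.

Lemma card_Zp (q : nat) : #|'Z_q.+2| = q.+2.
Proof. by rewrite card_ord. Qed.

(* Deletion-contraction gives both counts the recursion of a polynomial in the
   reciprocal of the modulus; contraction keeps a free coordinate, which accounts
   for the factor ['X]. *)
Lemma region_polynomial (R : realFieldType) {n m : nat} (A : m.-tuple (edge n)) :
  exists2 P : {poly rat}, P.[-1] = (#|realizable (R := R) A|)%:R &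
  exists Q : nat, forall q, (Q <= q)%N ->
    (#|colorings 'Z_q.+2 A|)%:R = q.+2%:R ^+ n * P.[q.+2%:R^-1].
Proof.
elim: m A => [|m IH] A.
  exists 1; first by rewrite hornerC card_realizable_nil.
  exists 0%N => q _; rewrite tuple0 hornerC mulr1.
  by rewrite (card_colorings_nil (F := 'Z_q.+2)) card_Zp natrX.
case/tupleP: A => e A; have [P1 rP1 [Q1 cP1]] := IH A.
have [le|ne] := eqVneq e.1.1 e.1.2.
  have [e0|e0] := eqVneq e.2 0.
    exists 0; first by rewrite horner0 card_realizable_loop // e0 eqxx.
    exists 0%N => q _; rewrite card_colorings_loop // e0 eqxx.
    by rewrite horner0 mulr0.
  exists P1; first by rewrite card_realizable_loop // (negPf e0) rP1.
  (* Once the modulus exceeds [|e.2|], the nonzero weight stays nonzero in ['Z_q.+2]. *)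
  exists (maxn Q1 `|e.2|%N) => q; rewrite geq_max => /andP [/cP1 <- qe].
  rewrite card_colorings_loop // dvdz_intr_Zp ifF //.
  apply/negP; rewrite dvdzE => /dvdn_leq; rewrite absz_gt0 e0 /= => /(_ isT).
  by move: qe; lia.
have [P2 rP2 [Q2 cP2]] := IH [tuple of map (contract e) A].
(* At -1 the minus sign of the point count becomes the plus sign of [card_realizable_link]. *)
exists (P1 - 'X * P2).
  by rewrite !hornerE /= rP1 rP2 card_realizable_link // natrD mulN1r opprK.
exists (maxn Q1 Q2) => q; rewrite geq_max => /andP [/cP1 {}cP1 /cP2 {}cP2].
have := card_colorings_link (F := 'Z_q.+2) e A ne; rewrite card_Zp.
move=> /(congr1 (fun k => k%:R : rat)); rewrite natrD !natrM cP1.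
rewrite [(#|colorings _ (map _ _)|)%:R]cP2 => E.
have q0 : q.+2%:R != 0 :> rat by rewrite pnatr_eq0.
apply: (mulfI q0); rewrite hornerD hornerN hornerM hornerX.
transitivity (q.+2%:R * (q.+2%:R ^+ n * P1.[q.+2%:R^-1]) -
              q.+2%:R ^+ n * P2.[q.+2%:R^-1]); first by rewrite -E addrK.
by rewrite mulrBr mulrBr [_ * (_^-1 * _)]mulrCA mulVKf.
Qed.

(** * The arrangement as an edge list, and its points over Z/q as placements on a circle *)

Definition complete_edges (n : nat) (a b : int) : seq (edge n) :=
  let pairs := [seq p : 'I_n * 'I_n <- enum {: 'I_n * 'I_n} | (p.1 < p.2)%N] in
  [seq (p, a + k%:Z) | p : 'I_n * 'I_n <- pairs, k : nat <- iota 0 `|b - a|%N.+1].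

Lemma complete_edgesP n (a b : int) (i j : 'I_n) (g : int) : a <= b ->
  reflect ((i < j)%N /\ a <= g <= b) ((i, j, g) \in complete_edges n a b).
Proof.
move=> ab; apply: (iffP allpairsP).
  move=> [[[i' j'] k] []].
  rewrite mem_filter mem_iota [_.1]/= => /andP [/= ij _] kk [-> -> ->].
  by split=> //; lia.
move=> [ij ag]; exists ((i, j), `|g - a|%N); split.
- by rewrite mem_filter /= ij mem_enum.
- by rewrite mem_iota [_.2]/=; lia.
- by rewrite /=; congr (_, _); lia.
Qed.

Lemma avoids_complete (F : comNzRingType) n (a b : int) (x : 'I_n -> F) : a <= b ->
  reflect (forall (i j : 'I_n) (g : int), (i < j)%N -> a <= g <= b ->
             x j - x i - g%:~R != 0)
          (avoids (complete_edges n a b) x).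
Proof.
move=> ab; apply: (iffP allP) => [H i j g ij ag|H [[i j] g]].
  by apply: (H (i, j, g)); apply/complete_edgesP.
by case/(complete_edgesP _ _ _ _ _ _ ab) => ij ag; apply: H.
Qed.

(** The disjunction says that [y j - y i] lies outside the window [d - b, b], the form in which the
    arrangement sees it. *)
Lemma spaced_pairs m (d : bool) b (y : 'I_m -> nat) :
  reflect (forall i j : 'I_m, (i < j)%N ->
     ((y i + b).+1 <= y j)%N || (y j + b + ~~ d <= y i)%N) (spaced d b y).
Proof.
apply: (iffP (spacedP _ _ _)) => [H i j ij|H j i].
  by have := H i j; have := H j i; rewrite /precedes /extra ij /=; lia.
rewrite /precedes /extra; case: (ltngtP i j) => [ij|ji|/val_inj ->].
  by have := H i j ij; rewrite orbF; lia.
  by have := H j i ji; rewrite orbT; lia.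
by rewrite ltnn andbF.
Qed.

Lemma dvdz_small (Q : nat) (t : int) : (Q%:Z %| t)%Z -> `|t| < Q%:Z -> t = 0.
Proof.
rewrite dvdzE /= => Qt tQ; apply/eqP; rewrite -absz_eq0; apply: contraTT Qt.
rewrite -lt0n => t0; apply/negP => /(dvdn_leq t0); lia.
Qed.

Section CyclicPlacements.
Variables (m M b q : nat) (d : bool).
(** For [m > 0] the circle of [q.+2] places splits into the place of x_0, [b] forbidden places after
    it, a segment of [L] places for the other coordinates, and [b - d] forbidden places before
    x_0. *)
Hypothesis (db : (d <= b)%N) (qE : (q.+2 + d = M + b * m.+1 + 1)%N).

Let L := (M + b * m.-1)%N.

Let place (y : 'I_m -> nat) (k : 'I_m.+1) : nat :=
  if unlift ord0 k is Some i then (y i + b).+1 else 0%N.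

Lemma avoids_place (c : 'Z_q.+2) (y : 'I_m -> nat) : (forall i, (y i < L)%N) ->
  avoids (complete_edges m.+1 (d%:Z - b%:Z) b) (fun k => c + (place y k)%:R) =
  spaced d b y.
Proof.
move=> yL; have gapE i j g : c + (place y j)%:R - (c + (place y i)%:R) - g%:~R =
    ((place y j)%:Z - (place y i)%:Z - g)%:~R :> 'Z_q.+2.
  by rewrite opprD addrACA subrr add0r !rmorphB.
have ab : d%:Z - b%:Z <= b%:Z by lia.
apply/(avoids_complete _ _ _ _ _ ab)/spaced_pairs => [H i j ij|H i j g ij ag].
  rewrite -[_ || _]negbK negb_or -!ltnNge; apply/negP => /andP [yi yj].
  have := H (lift ord0 i) (lift ord0 j) ((y j)%:Z - (y i)%:Z); rewrite gapE.
  rewrite /place !liftK /bump /= => /(_ ij) H'.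
  have /H' : d%:Z - b%:Z <= (y j)%:Z - (y i)%:Z <= b%:Z by lia.
  by rewrite (_ : _ - _ - _ = 0 :> int) ?eqxx //; lia.
(* There is no wrap-around: the integers in question are smaller than [q.+2] in absolute value, so
   they vanish modulo [q.+2] only if they vanish. *)
rewrite gapE dvdz_intr_Zp; apply/negP => /dvdz_small.
have Lq (k : 'I_m) : (L + b.*2 + 1 = q.+2 + d)%N.
  by have := ltn_ord k; rewrite /L; nia.
move: ij; rewrite /place; case: unliftP => [j' ->|->]; last by [].
case: unliftP => [i' ->|->] ij.
  have := H i' j' ij; have := yL i'; have := yL j'; have := Lq i'; lia.
by have := yL j'; have := Lq j'; lia.
Qed.

(** The rotation [x ord0] gives the factor [q.+2]; measured from it, the other coordinates form a
    spaced placement of width [L], which [card_spaced] shrinks to [M]. *)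
Lemma card_cyclic_colorings :
  #|colorings 'Z_q.+2 (complete_edges m.+1 (d%:Z - b%:Z) b)| =
  (q.+2 * #|[set y : {ffun 'I_m -> 'I_M} | spaced d 0 (vals y)]%SET|)%N.
Proof.
rewrite -(card_spaced m M b d); set S := [set y | _]%SET.
have -> : (q.+2 * #|S|)%N = #|finset.setX [set: 'Z_q.+2]%SET S|.
  by rewrite finset.cardsX finset.cardsT card_Zp.
pose Psi (p : 'Z_q.+2 * {ffun 'I_m -> 'I_L}) : {ffun 'I_m.+1 -> 'Z_q.+2} :=
  [ffun k => p.1 + (place (vals p.2) k)%:R].
have PsiE p : Psi p = (fun k => p.1 + (place (vals p.2) k)%:R) :> ('I_m.+1 -> _).
  by apply/funext => k; rewrite ffunE.
have Lq (k : 'I_m) : (L + b.*2 + 1 = q.+2 + d)%N.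
  by have := ltn_ord k; rewrite /L; nia.
have Psi_inj : injective Psi.
  move=> [c y] [c' y'] /ffunP e.
  have := e ord0; rewrite !ffunE /place unlift_none /= !addr0 => cc.
  rewrite -{}cc in e *.
  congr (_, _); apply/ffunP => i; apply: val_inj.
  have := e (lift ord0 i); rewrite !ffunE /place liftK /= => /addrI /(congr1 val).
  rewrite /= !Zp_nat /= /vals; have yL : (y i < L)%N := ltn_ord (y i).
  have y'L : (y' i < L)%N := ltn_ord (y' i).
  by have Li := Lq i; rewrite !modn_small /Zp_trunc /=; lia.
rewrite -(card_imset _ Psi_inj); apply: eq_card => x.
rewrite in_colorings; apply/idP/imsetP => [Ax|[[c y]]]; last first.
  rewrite !finset.in_set /= => sy ->; rewrite PsiE avoids_place //.
  by move=> i; apply: ltn_ord.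
have ab : d%:Z - b%:Z <= b%:Z by lia.
have xE k : x k = x ord0 + (val (x k - x ord0)%R)%:R.
  by rewrite natr_Zp addrC subrK.
pose u (i : 'I_m) := val (x (lift ord0 i) - x ord0)%R.
have uL i : (b < u i <= b + L)%N.
  have := fun g => avoids_complete _ _ _ _ _ ab Ax ord0 (lift ord0 i) g isT.
  have {}xE : x (lift ord0 i) - x ord0 = (u i)%:R by rewrite {1}xE addrC addKr.
  rewrite xE => H; have uq : (u i < q.+2)%N by apply: ltn_ord.
  (* The weight [u i] excludes x_0 and the [b] places after it, the weight [u i - q.+2] the [b - d]
     places before it. *)
  have /implyP := H (u i)%:Z; rewrite subrr eqxx implybF.
  have /implyP := H ((u i)%:Z - q.+2%:Z).
  rewrite rmorphB /= opprB addrCA subrr addr0 implybE.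
  have -> : q.+2%:~R = 0 :> 'Z_q.+2 by apply/eqP; rewrite dvdz_intr_Zp dvdzz.
  by rewrite eqxx orbF; have := Lq i; lia.
have u_lt i : (u i - b.+1 < L)%N by have := uL i; lia.
pose y : {ffun 'I_m -> 'I_L} := [ffun i => Ordinal (u_lt i)].
have xP : x = Psi (x ord0, y).
  apply/ffunP => k; rewrite [LHS]xE ffunE /place /vals; congr (_ + _).
  case: unliftP => [i ->|->]; last by rewrite subrr.
  by rewrite ffunE /= -addnS subnK //; case/andP: (uL i).
exists (x ord0, y) => //; rewrite !finset.in_set /=.
rewrite -(avoids_place (x ord0)) => [|i]; last exact: ltn_ord.
by have := PsiE (x ord0, y); rewrite -xP => <-.
Qed.

End CyclicPlacements.

(** * Identification of the polynomials and their values at -1 *)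

Lemma poly_eq_inv (P S : {poly rat}) (Q : nat) :
  (forall q, (Q <= q)%N -> P.[q.+2%:R^-1] = S.[q.+2%:R^-1]) -> P = S.
Proof.
move=> PS; apply/eqP; rewrite -subr_eq0; apply/negPn/negP => D0.
(* These reciprocals are distinct roots of [P - S], one more than its degree. *)
pose s : seq rat := [seq (k.+2%:R)^-1 | k <- iota Q (size (P - S))].
have rs : all (root (P - S)) s.
  apply/allP => x /mapP [k]; rewrite mem_iota => /andP [Qk _] ->.
  by rewrite rootE hornerD hornerN PS // subrr.
have us : uniq s.
  rewrite map_inj_uniq ?iota_uniq // => i j /invr_inj /eqP.
  by rewrite eqr_nat => /eqP [].
by have := max_poly_roots D0 rs us; rewrite size_map size_iota ltnn.
Qed.

Lemma card_realizable_shi (R : realFieldType) (m b : nat) : (0 < b)%N ->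
  #|realizable (R := R) (in_tuple (complete_edges m.+1 (1 - b%:Z) b))| =
  ((b * m.+1).+1 ^ m)%N.
Proof.
move=> b0; set A := in_tuple _; have [P rP [Q cP]] := region_polynomial R A.
have PE : P = (1 - (b * m.+1)%:R *: 'X) ^+ m.
  apply: (poly_eq_inv _ _ (Q + b * m.+1)) => q Qq.
  (* The value of [M] forced by [qE] for [d = 1]; the threshold on [q] makes the subtraction
     exact. *)
  pose M := (q.+2 - b * m.+1)%N.
  have qM : q.+2%:R != 0 :> rat by rewrite pnatr_eq0.
  have := cP q ltac:(lia); rewrite /A /=.
  rewrite (card_cyclic_colorings m M b q true) //; last by rewrite /M; nia.
  rewrite card_spaced_shi natrM natrX exprS -mulrA => /(mulfI qM) E.
  apply: (mulfI (expf_neq0 m qM)); rewrite -{}E.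
  rewrite horner_exp -exprMn /M natrB; last by lia.
  by rewrite !hornerE mulrBr mulr1 mulrCA divff // mulr1.
apply/eqP; rewrite -(eqr_nat rat) -rP PE horner_exp !hornerE.
by rewrite mulrN1 opprK natrX addrC natr1.
Qed.

Lemma card_realizable_catalan (R : realFieldType) (m b : nat) :
  #|realizable (R := R) (in_tuple (complete_edges m.+1 (- b%:Z) b))| =
  (\prod_(i < m) (b * m.+1 + i.+2))%N.
Proof.
set A := in_tuple _; have [P rP [Q cP]] := region_polynomial R A.
have PE : P = \prod_(i < m) (1 - (b * m.+1 + i.+1)%:R *: 'X).
  apply: (poly_eq_inv _ _ (Q + b * m.+1 + m)) => q Qq.
  (* For [d = 0] it is one smaller than in the Shi case; the summand [m] in the threshold keeps
     every factor [M - i] of the falling factorial exact. *)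
  pose M := (q.+1 - b * m.+1)%N.
  have qM : q.+2%:R != 0 :> rat by rewrite pnatr_eq0.
  have := cP q ltac:(lia); rewrite /A /= -(add0r (- b%:Z)).
  rewrite (card_cyclic_colorings m M b q false) //; last by rewrite /M; nia.
  rewrite card_spaced_catalan natrM exprS -mulrA => /(mulfI qM) E.
  apply: (mulfI (expf_neq0 m qM)); rewrite -{}E ffact_prod natr_prod horner_prod.
  rewrite -[in q.+2%:R ^+ m](card_ord m) -prodr_const -big_split /=.
  apply: eq_bigr => i _; have im := ltn_ord i.
  have -> : (M - i = q.+2 - (b * m.+1 + i.+1))%N by rewrite /M; lia.
  rewrite natrB; last by lia.
  by rewrite !hornerE mulrBr mulr1 mulrCA divff // mulr1.
apply/eqP; rewrite -(eqr_nat rat) -rP PE horner_prod natr_prod.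
by apply/eqP/eq_bigr => i _; rewrite !hornerE mulrN1 opprK addrC natr1 -addnS.
Qed.

(** * Connected components *)

Section Regions.
Context {R : realType} {n m : nat} (A : m.-tuple (edge n)).

Let complement : set 'rV[R]_n := [set x | avoids A (x ord0)].

Definition cell (t : m.-tuple bool) : set 'rV[R]_n :=
  [set x | avoids A (x ord0) /\ signs A (x ord0) = t].

Lemma gap_continuous (f : edge n) : continuous (fun x : 'rV[R]_n => gap f (x ord0)).
Proof.
have c k : continuous (fun x : 'rV[R]_n => x ord0 k) by apply: coord_continuous.
move=> x; apply: (continuousB (continuousB (c _ x) (c _ x))).
exact: cst_continuous.
Qed.

(** Intermediate values: the image of [C] under the gap is an interval that misses 0. *)
Lemma connected_gap_sign (C : set 'rV[R]_n) (f : edge n) (x y : 'rV[R]_n) :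
  connected C -> (forall z, C z -> gap f (z ord0) != 0) -> C x -> C y ->
  0 < gap f (x ord0) -> 0 < gap f (y ord0).
Proof.
move=> Cc C0 Cx Cy gx; rewrite ltNge; apply/negP => gy.
have /connected_intervalP CI : connected ((fun z : 'rV[R]_n => gap f (z ord0)) @` C).
  apply: connected_continuous_connected => //.
  by apply: continuous_subspaceT; apply: gap_continuous.
have /(CI _ _ (imageP _ Cy) (imageP _ Cx)) [z Cz z0] :
    gap f (y ord0) <= 0 <= gap f (x ord0) by rewrite gy ltW.
by move: (C0 z Cz); rewrite z0 eqxx.
Qed.

Lemma segment_continuous (x y : 'rV[R]_n) :
  continuous (fun t : R => (1 - t) *: x + t *: y).
Proof.
move=> t; apply: cvgD; apply: cvgZr_tmp => //.
by apply: cvgB => //; apply: cvg_cst.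
Qed.

(** Signs are constant on connected subsets of the complement; conversely, by convexity the segment
    between two points of a cell is a connected set inside the complement. *)
Lemma component_cell (x : 'rV[R]_n) : complement x ->
  connected_component complement x = cell (signs A (x ord0)).
Proof.
move=> Cx; apply/seteqP; split => y.
  move=> [C [Cx' CC Cc] Cy]; split; first exact: CC.
  have C0 f z : f \in tval A -> C z -> gap f (z ord0) != 0.
    by move=> fA /CC /allP; apply.
  apply: val_inj; apply/eq_in_map => f fA; apply/idP/idP;
    by apply: (connected_gap_sign C) => // z; apply: C0.
move=> [Cy sy]; pose s t : 'rV[R]_n := (1 - t) *: x + t *: y.
have s0 : s 0 = x by rewrite /s subr0 scale0r addr0 scale1r.
have s1 : s 1 = y by rewrite /s subrr scale0r add0r scale1r.
exists (s @` `[0, 1]); last by exists 1; rewrite //= in_itv /= ler01 lexx.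
split.
- by exists 0; rewrite //= in_itv /= ler01 lexx.
- move=> z [t /=]; rewrite in_itv /= => /andP [t0 t1] <-.
  have t1' : 0 <= 1 - t by lra.
  have [] := avoids_segment A (x ord0) (y ord0) _ _ t1' t0 (subrK _ _) Cx Cy (esym sy).
  move=> + _; rewrite /complement /=; congr (is_true (avoids _ _)).
  by apply/funext => k; rewrite /s !mxE.
- apply: connected_continuous_connected; first exact: segment_connected.
  by apply: continuous_subspaceT; apply: segment_continuous.
Qed.

Lemma card_components :
  ([set connected_component complement x | x in complement] #=
   `I_#|realizable (R := R) A|)%card.
Proof.
pose c (k : 'I_#|realizable (R := R) A|) := cell (enum_val k).
have pt (k : 'I_#|realizable (R := R) A|) :
    exists2 x : 'rV[R]_n, complement x & signs A (x ord0) = enum_val k.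
  have : enum_val k \in realizable (R := R) A := enum_valP k.
  move/realizableP => [x Ax sx].
  have xE : (\row_i x i) ord0 = x by apply/funext => i; rewrite mxE.
  by exists (\row_i x i); rewrite /complement /= xE.
have -> : [set connected_component complement x | x in complement] = c @` setT.
  apply/seteqP; split => _ [x Cx <-].
    have rx : signs A (x ord0) \in realizable (R := R) A.
      by apply/realizableP; exists (x ord0).
    by exists (enum_rank_in rx (signs A (x ord0))) => //;
      rewrite component_cell // /c enum_rankK_in.
  by have [y Cy sy] := pt x; exists y => //; rewrite component_cell // sy.
apply: card_eq_trans (card_esym card_II).
apply: inj_card_eq => i j _ _ cij; apply: enum_val_inj.
have [x Cx sx] := pt i; have : c i x by split.
by rewrite cij => -[_ <-].
Qed.

End Regions.

Lemma num_regions (R : realType) (n : nat) (a b : int) : a <= b ->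
  has_num_regions (arrangementK R n a b)
    #|realizable (R := R) (in_tuple (complete_edges n a b))|.
Proof.
move=> ab; rewrite /has_num_regions /regions.
rewrite (_ : arr_complement _ = [set x | avoids (complete_edges n a b) (x ord0)]).
  exact: card_components (in_tuple _).
apply/seteqP; split => x /=.
  move=> Cx; apply/(avoids_complete _ _ _ _ _ ab) => i j g ij ag.
  apply/eqP => /eqP; rewrite subr_eq0 => /eqP xg; apply: Cx.
  by exists (hyperplane R i j g) => //; exists i, j, g.
move=> /(avoids_complete _ _ _ _ _ ab) Ax [_ [i [j [g [ij ag ->]]]] /= xg].
by have := Ax i j g ij ag; rewrite xg subrr eqxx.
Qed.

Theorem corollary12 (R : realType) (n : nat) (a b : int)
    (hn : (1 <= n)%N) (hab : a <= b) :
  (a + b = 0 ->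
     exists N : nat, has_num_regions (arrangementK R n a b) N /\
       N%:Z = \prod_(2 <= k < n.+1) (b * n%:Z + k%:Z)) /\
  (a + b = 1 ->
     exists N : nat, has_num_regions (arrangementK R n a b) N /\
       N%:Z = (b * n%:Z + 1) ^+ n.-1).
Proof.
case: n hn => // m _; split => ab.
  (* [a <= b] and [a + b = 0] force [b >= 0]. *)
  have [c bc ac] : exists2 c : nat, b = c & a = - c%:Z by exists `|b|%N; lia.
  subst a b; eexists; split; first exact: num_regions.
  rewrite card_realizable_catalan (big_morph Posz PoszM (erefl _)).
  by rewrite !big_add1 big_mkord; apply: eq_bigr.
(* [a <= b] and [a + b = 1] force [b >= 1], which yields [d <= b] for [d = 1]. *)
have [c bc [ac c0]] : exists2 c : nat, b = c & a = 1 - c%:Z /\ (0 < c)%N.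
  by exists `|b|%N; lia.
subst a b; eexists; split; first exact: num_regions.
rewrite card_realizable_shi // -[LHS]natz natrX; congr (_ ^+ _).
by rewrite natz; lia.
Qed.
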